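(* Let $T$ be a caterpillar with central path $\mathcal{P}$ and $m_t(T)\ge 6$ such that $T$ is not total pivoted. Assume that there exists a total dense element outside $\mathcal{P}$. Then $\varphi_t(T)=m_t(T)$.
   Context: A caterpillar is a tree $T$ with a central path $\mathcal{P}$ (the path formed by its non-leaf vertices) such that every leaf is at distance one from $\mathcal{P}$; an element outside $\mathcal{P}$ is a vertex not on $\mathcal{P}$ or an edge not in $\mathcal{P}$. For a simple graph: elements are vertices and edges; two elements are adjacent if they are adjacent vertices, a vertex and an incident edge, or two distinct edges sharing an endpoint; $N_t(x)$ is the set of elements adjacent to $x$ and $d_t(x)=|N_t(x)|$. With elements ordered by non-increasing total degree $d_t(x_1)\ge d_t(x_2)\ge\cdots$, $m_t(G)=\max\{i:d_t(x_i)\ge i-1\}$. With $m=m_t(G)$, an element $x$ is total dense if $d_t(x)\ge m-1$. A path $\langle w_1,\dots,w_k\rangle$ is a total dense path if $w_2,\dots,w_{k-1}$ are total dense and every edge $(w_i,w_{i+1})$ is total dense; its length $\ell$ is its number of edges. Two paths are adjacent if the last vertex of one equals the first vertex of the other. A caterpillar $T$ with $m=m_t(T)\ge 6$ and exactly $m$ total dense elements is total pivoted if either (1) there is a total dense vertex $u$ with $d(u)=m-2$ having a neighbour $u'$ with $d(u')=2$ that is adjacent to a total dense vertex $v\ne u$; or (2) there are paths $P_1,P_2,Q\subseteq\mathcal{P}$ such that $P_1,P_2$ are the only total dense paths of $T$, each contains exactly three total dense elements, $Q$ has $\ell(Q)\le 1$ and no total dense element, and $Q$ is adjacent to both $P_1$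 and $P_2$. A total $k$-colouring is a surjective map from elements to $\{1,\dots,k\}$ giving adjacent elements different colours; an element $x$ is total b-chromatic if $\mathbf{c}(N_t(x))=\{1,\dots,k\}\setminus\{\mathbf{c}(x)\}$; a total b-chromatic $k$-colouring has a total b-chromatic element in every colour class; $\varphi_t(T)$ is the maximum such $k$. *)

(* Defs.v *)
From mathcomp Require Import all_boot.

Set Implicit Arguments.
Unset Strict Implicit.
Unset Printing Implicit Defensive.

Section Graph.

Variables (V : finType) (e : rel V).

Definition simple_graph : Prop := symmetric e /\ irreflexive e.

Definition deg (v : V) : nat := #|[set w | e v w]|.

Definition leaf (v : V) : bool := deg v == 1.

(* Duplicate-free [e]-cycles of length at most 2 are degenerate (a single edge
   travelled back and forth). *)
Definition acyclic : Prop := forall c : seq V, ucycle e c -> size c <= 2.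

Definition tree : Prop :=
  [/\ 0 < #|V|, forall x y : V, connect e x y & acyclic].

(* A path is given by the sequence of its vertices, so a path and its reversal
   are different sequences; its length is [(size w).-1]. *)
Definition is_path (w : seq V) : bool := [&& 0 < size w, sorted e w & uniq w].

Definition path_edges (w : seq V) : seq {set V} :=
  [seq [set q.1; q.2] | q <- zip w (behead w)].

Definition central_path (p : seq V) : Prop :=
  is_path p /\ forall v : V, (v \in p) = ~~ leaf v.

Definition caterpillar (p : seq V) : Prop :=
  [/\ tree, central_path p
    & forall v : V, leaf v -> exists2 w, w \in p & e v w].

Definition edges : {set {set V}} :=
  [set [set q.1; q.2] | q : V * V & e q.1 q.2].

Definition edge : finType := {E : {set V} | E \in edges}.

Definition elt : finType := (V + edge)%type.

Definition elt_adj (x y : elt) : bool :=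
  match x, y with
  | inl u, inl v => e u v
  | inl u, inr E => u \in val E
  | inr E, inl u => u \in val E
  | inr E, inr F => (E != F) && (val E :&: val F != set0)
  end.

Definition total_nbhd (x : elt) : {set elt} := [set y | elt_adj x y].

Definition total_deg (x : elt) : nat := #|total_nbhd x|.

Definition total_degs : seq nat := sort geq [seq total_deg x | x : elt].

(* The index [i] starts at 0 here: [i.+1] is the 1-based rank, so that
   [i <= nth 0 total_degs i] reads d_t(x_(i+1)) >= (i+1) - 1. *)
Definition m_t : nat :=
  \max_(i < size total_degs | i <= nth 0 total_degs i) i.+1.

Definition total_dense (x : elt) : bool := m_t.-1 <= total_deg x.

Definition on_path (w : seq V) (x : elt) : bool :=
  match x with
  | inl v => v \in w
  | inr E => val E \in path_edges w
  end.

Definition interior (w : seq V) : seq V := take (size w).-2 (behead w).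

Definition total_dense_path (w : seq V) : Prop :=
  [/\ is_path w,
      forall v : V, v \in interior w -> total_dense (inl v)
    & forall E : edge, val E \in path_edges w -> total_dense (inr E)].

(* Every one-vertex path is vacuously a total dense path, and every subpath of
   a total dense path is one; hence the total dense paths to be enumerated are
   the maximal ones having at least one edge. *)
Definition maximal_total_dense_path (w : seq V) : Prop :=
  [/\ total_dense_path w, 1 < size w
    & forall w' : seq V, total_dense_path w' -> infix w w' -> w' = w].

Definition num_total_dense_on (w : seq V) : nat :=
  #|[set x : elt | on_path w x && total_dense x]|.

Definition paths_adjacent (w w' : seq V) : bool :=
  (ohead (rev w) == ohead w') || (ohead (rev w') == ohead w).

Definition pivot_vertex : Prop :=
  exists u u' v : V,
    [/\ total_dense (inl u), deg u = m_t - 2, e u u' /\ deg u' = 2, e u' v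
      & total_dense (inl v) /\ v <> u].

(* [P1] and [P2] are two different paths also when orientation is ignored. *)
Definition pivot_paths (p : seq V) : Prop :=
  exists P1 P2 Q : seq V,
    [/\ [/\ is_path P1, is_path P2 & is_path Q],
        [/\ {subset P1 <= p}, {subset P2 <= p} & {subset Q <= p}],
        [/\ P1 != P2, P1 != rev P2 &
            forall w : seq V, maximal_total_dense_path w <->
              w \in [:: P1; rev P1; P2; rev P2]],
        num_total_dense_on P1 = 3 /\ num_total_dense_on P2 = 3
      & [/\ (size Q).-1 <= 1, num_total_dense_on Q = 0,
            paths_adjacent Q P1 & paths_adjacent Q P2]].

Definition total_pivoted (p : seq V) : Prop :=
  [/\ 6 <= m_t, #|[set x : elt | total_dense x]| = m_t
    & pivot_vertex \/ pivot_paths p].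

Definition total_colouring (k : nat) (c : {ffun elt -> 'I_k}) : bool :=
  [forall j : 'I_k, exists x : elt, c x == j] &&
  [forall x : elt, forall y : elt, elt_adj x y ==> (c x != c y)].

Definition total_b_chromatic (k : nat) (c : {ffun elt -> 'I_k}) (x : elt)
  : bool :=
  c @: total_nbhd x == [set~ c x].

Definition total_b_colouring (k : nat) (c : {ffun elt -> 'I_k}) : bool :=
  total_colouring c &&
  [forall j : 'I_k, exists x : elt, (c x == j) && total_b_chromatic c x].

(* The bound on [k] loses nothing: see [phi_t_max]. *)
Definition phi_t : nat :=
  \max_(k < #|elt|.+1 | [exists c : {ffun elt -> 'I_k}, total_b_colouring c]) k.

Lemma phi_t_max (k : nat) (c : {ffun elt -> 'I_k}) :
  total_b_colouring c -> k <= phi_t.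
Proof.
move=> bc; have lek : k < #|elt|.+1.
  case/andP: (bc) => /andP[/forallP surj _] _.
  have imc : [set: 'I_k] \subset c @: [set: elt].
    apply/subsetP=> j _; case/existsP: (surj j) => x /eqP <-.
    exact: imset_f.
  rewrite ltnS; have := subset_leq_card imc; rewrite cardsT card_ord => lek.
  by apply: leq_trans lek (leq_trans (leq_imset_card _ _) _); rewrite cardsT.
apply: (@leq_bigmax_cond _ _ (fun i : 'I_(#|elt|.+1) => i : nat) (Ordinal lek)).
by apply/existsP; exists c.
Qed.

End Graph.

(* Main.v *)
(** The colouring with m = m_t colours is built by growing a partial colouring
    from a vertex v, one vertex and one edge at a time, with the coloured
    vertices always spanning a subtree; only the tree structure matters. A
    total dense element outside the central path is a pendant edge at some v,
    so that m - 2 <= d(v) <= m - 1; all degrees are less than m, so greedy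
    extension never fails. If d(v) = m - 1, then v and its edges already are
    b-chromatic in m different colours. If d(v) = m - 2, then v and its edges
    use all colours but one, j, and they are b-chromatic as soon as every
    neighbour y of v has colour j or lies on another edge of colour j. What
    remains is to make a total dense element x away from v b-chromatic in
    colour j, colouring the path from v to x suitably and then spending the
    uncoloured neighbourhood of x on the colours x does not see yet. This
    fails only if x is a vertex joined to v through a vertex y of degree 2;
    since T is not total pivoted there are then two such vertices x and x',
    reached through y and y'. Now x gets colour j, and x' takes over the colour
    of the edge vy, the only one that need not be b-chromatic. *)
Require Import Defs.
From mathcomp Require Import all_boot zify.

Set Implicit Arguments.
Unset Strict Implicit.
Unset Printing Implicit Defensive.

Lemma fresh (C : finType) (s : seq C) : size s < #|C| -> exists c, c \notin s.
Proof.
move=> lts; apply/existsP; apply: contraTT lts => /existsPn all_s.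
rewrite -leqNgt; apply: leq_trans (card_size s).
by apply: subset_leq_card; apply/subsetP => c _; have := all_s c; rewrite negbK.
Qed.

(** * Subtrees *)

Section Trees.

Variables (V : finType) (e : rel V).
Hypotheses (e_sym : symmetric e) (e_irr : irreflexive e) (e_acyc : acyclic e).

Definition induced (S : {set V}) : rel V :=
  [rel a b | [&& e a b, a \in S & b \in S]].

(** Only connectedness is asked for: acyclicity is inherited from [e]. *)
Definition subtree (S : {set V}) : Prop :=
  {in S &, forall x y, connect (induced S) x y}.

Lemma induced_sym S : symmetric (induced S).
Proof. by move=> a b; rewrite /induced /= e_sym (andbC (a \in S)). Qed.

Lemma edge_neq x y : e x y -> x != y.
Proof. by apply: contraTneq => ->; rewrite e_irr. Qed.

(** The edge [xz] would close the path to a duplicate-free cycle on at least three vertices. *)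
Lemma long_path_not_adj x y z q :
  path e x (y :: rcons q z) -> uniq (x :: y :: rcons q z) -> ~~ e x z.
Proof.
move=> pq uq; apply/negP => exz.
have : ucycle e (x :: y :: rcons q z).
  by rewrite /ucycle uq andbT /cycle rcons_path pq /= last_rcons e_sym.
by move/e_acyc; rewrite /= size_rcons.
Qed.

Lemma no_triangle x y z : e x y -> e y z -> ~~ e x z.
Proof.
move=> exy eyz; have [->|xz] := eqVneq x z; first by rewrite e_irr.
apply: (@long_path_not_adj x y z [::]); rewrite /= ?exy ?eyz //.
by rewrite !inE negb_or xz !edge_neq.
Qed.

Lemma subtree1 x : subtree [set x].
Proof. by move=> a b /set1P-> /set1P->; exact: connect0. Qed.

Lemma subtreeU S w u : subtree S -> w \in S -> e w u -> subtree (u |: S).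
Proof.
move=> tS wS ewu.
have sub : subrel (connect (induced S)) (connect (induced (u |: S))).
  apply: connect_sub => a b /and3P[eab aS bS]; apply: connect1.
  by rewrite /induced /= eab !inE aS bS !orbT.
have to_w x : x \in u |: S -> connect (induced (u |: S)) x w.
  case/setU1P=> [->|xS]; last exact/sub/tS.
  by apply: connect1; rewrite /induced /= e_sym ewu !inE eqxx wS orbT.
move=> x y xS yS; apply: connect_trans (to_w _ xS) _.
by rewrite (sym_connect_sym (@induced_sym _)) to_w.
Qed.

(** A path from [w] to [w'] inside [S] avoids [u], so two distinct neighbours would close a cycle
    through [u]. Hence a new vertex is attached to the coloured part by exactly one edge, which
    keeps every greedy step local. *)
Lemma uniq_nbr S u w w' : subtree S -> u \notin S -> w \in S -> w' \in S ->
  e u w -> e u w' -> w = w'.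
Proof.
move=> tS uS wS w'S euw euw'; apply/eqP/negP => /negP neq.
have /connectP[q0 pq0 lq0] := tS _ _ wS w'S.
case/shortenP: pq0 lq0 => q pq uq _ lq.
have qS : {subset w :: q <= S}.
  move=> a; rewrite inE => /predU1P[->//|aq].
  elim: q w {wS euw neq uq lq} pq aq => // b q IH w /=.
  by case/andP=> /and3P[_ _ bS] pq; rewrite inE => /predU1P[->//|]; apply: IH pq.
case/lastP: q => [|q z] in pq uq lq qS *.
  by rewrite /= in lq; rewrite lq eqxx in neq.
rewrite last_rcons in lq; subst z.
move: euw'; apply/negP; apply: (@long_path_not_adj u w w' q).
  rewrite /= euw /=; apply: sub_path pq => a b /and3P[]//.
by rewrite cons_uniq uq andbT; apply: contra uS => /qS.
Qed.

(** * Partial colourings of a tree *)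

Section PartialColourings.

Variable C : finType.

(* [ec x y] is the colour of the edge [xy]; only the values of [vc] and [ec] on
   [dom] are meaningful. *)
Record pcol := PCol { dom : {set V}; vc : V -> C; ec : V -> V -> C }.

Implicit Types P Q R : pcol.

Definition nbr P x : {set V} := [set y in dom P | e x y].

Definition outside P x : {set V} := [set y | e x y & y \notin dom P].

(** Comparing an edge with its end [x] suffices: the clause also applies to the pair [y], [x], and
    [ec] is symmetric there. *)
Definition valid P : Prop :=
  [/\ subtree (dom P),
      {in dom P &, forall x y, e x y ->
        [/\ vc P x != vc P y, ec P x y != vc P x & ec P x y = ec P y x]}
    & {in dom P & &, forall x y z, e x y -> e x z ->
        ec P x y = ec P x z -> y = z}].

Definition ext P Q : Prop :=
  [/\ dom P \subset dom Q, {in dom P, vc Q =1 vc P}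
    & {in dom P &, ec Q =2 ec P}].

(** All pairs containing [u] receive [a]; among them only the one formed with the coloured neighbour
    of [u] is an edge inside the new domain. *)
Definition addv P u a b : pcol :=
  PCol (u |: dom P) (fun x => if x == u then b else vc P x)
       (fun x y => if (x == u) || (y == u) then a else ec P x y).

Definition taken P w : {set C} := vc P w |: ec P w @: nbr P w.

(** Once this set is [setT], the vertex [x] is b-chromatic, however the colouring is continued. *)
Definition seenV P x : {set C} :=
  vc P x |: (vc P @: nbr P x :|: ec P x @: nbr P x).

(* The colour of the edge [xy] itself is among these, as [y \in nbr P x]. *)
Definition seenE P x y : {set C} :=
  [set vc P x; vc P y] :|: (ec P x @: nbr P x :|: ec P y @: nbr P y).

Lemma nbrE P x y : (y \in nbr P x) = (y \in dom P) && e x y.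
Proof. by rewrite inE. Qed.

Lemma outsideE P x y : (y \in outside P x) = e x y && (y \notin dom P).
Proof. by rewrite inE. Qed.

Lemma card_nbr_outside P x : #|nbr P x| + #|outside P x| = deg e x.
Proof.
rewrite /deg -(cardsID (dom P) [set w | e x w]); congr (_ + _).
  by apply: eq_card => y; rewrite !inE andbC.
by apply: eq_card => y; rewrite !inE andbC.
Qed.

Definition single v c : pcol := PCol [set v] (fun _ => c) (fun _ _ => c).

Lemma valid_single v c : valid (single v c).
Proof.
split=> /=; first exact: subtree1.
  by move=> x y /set1P-> /set1P->; rewrite e_irr.
by move=> x y z /set1P-> /set1P->; rewrite e_irr.
Qed.

Lemma ext_trans Q P R : ext P Q -> ext Q R -> ext P R.
Proof.
case=> sPQ vPQ ePQ [sQR vQR eQR]; split; first exact: subset_trans sQR.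
  by move=> x xP; rewrite vQR ?vPQ ?(subsetP sPQ).
by move=> x y xP yP; rewrite eQR ?ePQ ?(subsetP sPQ).
Qed.

Lemma ext_nbr P Q x : ext P Q -> nbr P x \subset nbr Q x.
Proof.
by case=> sPQ _ _; apply/subsetP => y; rewrite !nbrE => /andP[/(subsetP sPQ)-> ->].
Qed.

Lemma ext_ec P Q x : ext P Q -> x \in dom P ->
  ec P x @: nbr P x \subset ec Q x @: nbr Q x.
Proof.
move=> ePQ xP; have [_ _ eqe] := ePQ; apply/subsetP => _ /imsetP[y yN ->].
rewrite -eqe //; last by move: yN; rewrite nbrE => /andP[].
exact/imset_f/(subsetP (ext_nbr x ePQ)).
Qed.

Lemma ext_seenV P Q x : ext P Q -> x \in dom P -> seenV P x \subset seenV Q x.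
Proof.
move=> ePQ xP; have [_ eqv _] := ePQ; rewrite /seenV eqv //.
apply/setUS/setUSS; last exact: ext_ec.
apply/subsetP => _ /imsetP[y yN ->]; rewrite -eqv; last first.
  by move: yN; rewrite nbrE => /andP[].
exact/imset_f/(subsetP (ext_nbr x ePQ)).
Qed.

Lemma ext_seenE P Q x y : ext P Q -> x \in dom P -> y \in dom P ->
  seenE P x y \subset seenE Q x y.
Proof.
move=> ePQ xP yP; have [_ eqv _] := ePQ; rewrite /seenE !eqv //.
by apply/setUS/setUSS; apply: ext_ec.
Qed.

(** * Attaching one new vertex *)

Section AddVertex.

Variables (P : pcol) (w u : V) (a b : C).
Hypotheses (pP : valid P) (wP : w \in dom P) (uP : u \notin dom P) (ewu : e w u).

Let tP : subtree (dom P). Proof. by case: pP. Qed.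

Lemma adj_new x : x \in dom P -> e x u -> x = w.
Proof.
by move=> xP exu; apply: (uniq_nbr tP uP); rewrite // e_sym.
Qed.

Lemma neq_new x : x \in dom P -> (x == u) = false.
Proof. by move=> xP; apply: contraNF uP => /eqP<-. Qed.

Lemma ext_addv : ext P (addv P u a b).
Proof.
split; first exact: subsetUr.
  by move=> x xP; rewrite /= neq_new.
by move=> x y xP yP; rewrite /= !neq_new.
Qed.

Lemma nbr_addv x : x \in dom P -> x != w -> nbr (addv P u a b) x = nbr P x.
Proof.
move=> xP xw; apply/setP=> y; rewrite !nbrE !inE.
have [->|//] := eqVneq y u; rewrite (negbTE uP) /=.
by apply: contraNF xw => /(adj_new xP)->.
Qed.

Lemma nbr_addv_at : nbr (addv P u a b) w = u |: nbr P w.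
Proof.
apply/setP=> y; rewrite !inE.
by have [->|//] := eqVneq y u; rewrite ewu.
Qed.

Lemma nbr_addv_new : nbr (addv P u a b) u = [set w].
Proof.
apply/setP=> y; rewrite !inE; have [->|yu] := eqVneq y u.
  by rewrite e_irr; apply/esym/negbTE; apply: contraTneq wP => <-.
apply/idP/eqP => [/andP[yP euy]|->]; first by apply: adj_new; rewrite // e_sym.
by rewrite wP e_sym.
Qed.

Lemma outside_addv x : x \in dom P -> x != w ->
  outside (addv P u a b) x = outside P x.
Proof.
move=> xP xw; apply/setP=> y; rewrite !inE.
have [->|//] := eqVneq y u; rewrite /= andbF; apply/esym.
by apply: contraNF xw => /andP[/(adj_new xP)->].
Qed.

Lemma outside_addv_at : outside (addv P u a b) w = outside P w :\ u.
Proof.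
by apply/setP=> y; rewrite !inE; have [->|] := eqVneq y u; rewrite //= ?andbF.
Qed.

Lemma card_outside_at : #|outside P w| = #|outside (addv P u a b) w|.+1.
Proof. by rewrite outside_addv_at (cardsD1 u) outsideE ewu uP. Qed.

(** Since [w] is the only coloured neighbour of [u], the new edge can conflict only at [w] and with
    [u], and the new vertex only with [w] and the new edge. *)
Lemma valid_addv : a \notin taken P w -> b \notin [:: a; vc P w] ->
  valid (addv P u a b).
Proof.
rewrite !inE !negb_or => /andP[aw aN] /andP[ba bw].
have [_ Hv He] := pP.
have aE y : y \in dom P -> e w y -> ec P w y != a.
  by move=> yP ewy; apply: contra aN => /eqP<-; apply: imset_f; rewrite nbrE yP.
split=> /=; first exact: (subtreeU tP wP ewu).
  move=> x y /setU1P[->|xP] /setU1P[->|yP] exy.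
  - by rewrite e_irr in exy.
  - rewrite e_sym in exy; have yw := adj_new yP exy; subst y.
    by rewrite eqxx /= neq_new // orbT eq_sym; split; rewrite // eq_sym.
  - have xw := adj_new xP exy; subst x.
    by rewrite eqxx /= neq_new // orbT eq_sym; split.
  - by rewrite !neq_new //=; apply: Hv.
move=> x y z /setU1P[->|xP] /setU1P[->|yP] /setU1P[->|zP] exy exz //=.
- by rewrite e_irr in exy.
- by rewrite e_irr in exz.
- by rewrite (adj_new yP) 1?e_sym // (adj_new zP) // e_sym.
- rewrite (neq_new xP) (neq_new zP) eqxx /=; have xw := adj_new xP exy; subst x.
  by move=> /esym/eqP; rewrite (negbTE (aE _ zP exz)).
- rewrite (neq_new xP) (neq_new yP) eqxx /=; have xw := adj_new xP exz; subst x.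
  by move/eqP; rewrite (negbTE (aE _ yP exy)).
- by rewrite (neq_new xP) (neq_new yP) (neq_new zP) /=; apply: He.
Qed.

End AddVertex.

Lemma card_taken P w : #|taken P w| <= #|nbr P w|.+1.
Proof.
rewrite /taken cardsU1 -add1n; apply: leq_add; first exact: leq_b1.
exact: leq_imset_card.
Qed.

Lemma fresh_set (A : {set C}) (s : seq C) : #|A| + size s < #|C| ->
  exists c, c \notin A /\ c \notin s.
Proof.
move=> lt; case: (@fresh C (enum A ++ s)); first by rewrite size_cat -cardE.
by move=> c; rewrite mem_cat mem_enum negb_or => /andP[]; exists c.
Qed.

(** * Spending the uncoloured neighbours of a vertex or an edge *)

Section Fill.

Variables (w : V) (inv : pcol -> Prop).
Hypothesis step : forall P u, valid P -> w \in dom P -> inv P ->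
  u \notin dom P -> e w u -> exists a b,
    [/\ a \notin taken P w, b \notin [:: a; vc P w] & inv (addv P u a b)].

(** Induction on the number of uncoloured neighbours of [w]. Each new vertex is adjacent to no
    coloured vertex but [w], so coloured neighbourhoods elsewhere stay the same. *)
Lemma fill P : valid P -> w \in dom P -> inv P ->
  exists Q, [/\ valid Q, ext P Q, inv Q, outside Q w = set0
    & {in dom P, forall x, x != w -> nbr Q x = nbr P x}].
Proof.
move: {2}#|outside P w| (erefl #|outside P w|) => k.
elim: k P => [|k IH] P cP pP wP iP.
  exists P; split=> //.
  by apply/eqP; rewrite -cards_eq0 cP.
have /card_gt0P[u] : 0 < #|outside P w| by rewrite cP.
rewrite outsideE => /andP[ewu uP].
have [a [b [aw bw iQ]]] := step pP wP iP uP ewu.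
have eQ := ext_addv a b uP.
have [||||R [pR eR iR oR nR]] := IH (addv P u a b) => //.
- by move: cP; rewrite (card_outside_at a b uP ewu) => -[].
- exact: valid_addv wP uP ewu aw bw.
- by rewrite /= inE wP orbT.
exists R; split=> //; first exact: ext_trans eQ eR.
move=> x xP xw; rewrite nR ?(nbr_addv _ _ pP wP uP ewu) //.
by rewrite /= inE xP orbT.
Qed.

End Fill.

Lemma fresh_out (A : {set C}) : A != setT -> exists c, c \notin A.
Proof.
by rewrite -subTset => /subsetPn[c _ cA]; exists c.
Qed.

(** At most [#|nbr P w| + 1] colours are taken, which is at most [deg e w] because [u] is still
    uncoloured. *)
Lemma free_colour P w u : deg e w < #|C| -> u \notin dom P -> e w u ->
  exists a, a \notin taken P w.
Proof.
move=> ltD uP ewu; apply: fresh_out; apply: contraTneq ltD => eqT.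
rewrite -leqNgt -cardsT -eqT (leq_trans (card_taken _ _)) //.
rewrite -(card_nbr_outside P w) -addn1 leq_add2l.
by apply/card_gt0P; exists u; rewrite outsideE ewu.
Qed.

(** Each uncoloured neighbour of [x] can show [x] two new colours, its own and that of its edge; the
    invariant says that this is enough to reach all of [C]. *)
Lemma fillV P x : 2 < #|C| -> deg e x < #|C| ->
  valid P -> x \in dom P -> #|C| <= #|seenV P x| + 2 * #|outside P x| ->
  exists Q, [/\ valid Q, ext P Q, seenV Q x = setT
    & {in dom P, forall y, y != x -> nbr Q y = nbr P y}].
Proof.
move=> C2 ltD pP xP iP.
pose inv Q := #|C| <= #|seenV Q x| + 2 * #|outside Q x|.
have [|Q [pQ eQ iQ oQ nQ]] := @fill x inv _ P pP xP iP; last first.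
  exists Q; split=> //; apply/eqP; rewrite eqEcard subsetT cardsT.
  by move: iQ; rewrite /inv oQ cards0 muln0 addn0.
move=> {pP xP iP}P u pP xP iP uP exu.
have sub_taken : taken P x \subset seenV P x by apply/setUS/subsetUr.
(* An unseen colour is never taken, so the edge gets one as long as one exists; otherwise any free
   colour will do. The vertex colour [b] is chosen in the same way. *)
have [a [aT aS]] : exists a, a \notin taken P x /\
    (seenV P x = setT \/ a \notin seenV P x).
  have [sT|/fresh_out[a aS]] := eqVneq (seenV P x) setT.
    by have [a aT] := free_colour ltD uP exu; exists a; split; last left.
  by exists a; split; [apply: contra aS => /(subsetP sub_taken) | right].
have [b [bT bS]] : exists b, b \notin [:: a; vc P x] /\
    (a |: seenV P x = setT \/ b \notin a |: seenV P x).
  have [sT|/fresh_out[b bS]] := eqVneq (a |: seenV P x) setT.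
    by have [b bT] := @fresh C [:: a; vc P x] C2; exists b; split; last left.
  exists b; split; last by right.
  by apply: contra bS; rewrite !inE => /orP[]->; rewrite ?orbT.
exists a, b; split=> //.
have eQ := ext_addv a b uP.
have sub : b |: (a |: seenV P x) \subset seenV (addv P u a b) x.
  rewrite 2!subUset ext_seenV // andbT !sub1set /seenV nbr_addv_at //.
  by rewrite !imsetU1 /= !eqxx orbT !inE !eqxx !orbT.
have le_sub := subset_leq_card sub.
have oP := card_outside_at a b uP exu.
rewrite /inv in iP *.
case: bS => [sT|bS]; first by move: le_sub; rewrite sT setUT cardsT; lia.
case: aS => [sT|aS]; first by rewrite sT setUT inE in bS.
move: le_sub; rewrite cardsU1 bS cardsU1 aS; lia.
Qed.

(** For an edge, an uncoloured neighbour of an end counts only once: its edge is adjacent to [xy],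
    the vertex itself is not. The two ends are filled one after the other. *)
Lemma fillE P x y : 2 < #|C| -> deg e x < #|C| -> deg e y < #|C| ->
  valid P -> x \in dom P -> y \in dom P -> e x y ->
  #|C| <= #|seenE P x y| + #|outside P x| + #|outside P y| ->
  exists Q, [/\ valid Q, ext P Q & seenE Q x y = setT].
Proof.
move=> C2 ltDx ltDy pP xP yP exy iP.
pose inv z t Q := t \in dom Q /\
  #|C| <= #|seenE Q z t| + #|outside Q z| + #|outside Q t|.
have seenC Q z t : seenE Q z t = seenE Q t z.
  by congr (_ :|: _); exact: setUC.
have step z t : e z t -> deg e z < #|C| -> forall P u, valid P -> z \in dom P ->
    inv z t P -> u \notin dom P -> e z u -> exists a b,
    [/\ a \notin taken P z, b \notin [:: a; vc P z] & inv z t (addv P u a b)].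
  move=> ezt ltD {pP xP iP yP}P u pP zP [tP iP] uP ezu.
  have sub_taken : taken P z \subset seenE P z t.
    rewrite /seenE /taken; apply: setUSS; last exact: subsetUl.
    by rewrite sub1set set21.
  have [a [aT aS]] : exists a, a \notin taken P z /\
      (seenE P z t = setT \/ a \notin seenE P z t).
    have [sT|/fresh_out[a aS]] := eqVneq (seenE P z t) setT.
      by have [a aT] := free_colour ltD uP ezu; exists a; split; last left.
    by exists a; split; [apply: contra aS => /(subsetP sub_taken) | right].
  have [b bT] := @fresh C [:: a; vc P z] C2.
  exists a, b; split=> //; split; first by rewrite /= inE tP orbT.
  have eQ := ext_addv a b uP.
  have sub : a |: seenE P z t \subset seenE (addv P u a b) z t.
    rewrite subUset ext_seenE // andbT sub1set /seenE nbr_addv_at //.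
    by rewrite !imsetU1 /= !eqxx orbT !inE eqxx !orbT.
  have le_sub := subset_leq_card sub.
  have oz := card_outside_at a b uP ezu.
  have -> : outside (addv P u a b) t = outside P t.
    by apply: (outside_addv _ _ pP zP uP ezu); rewrite // eq_sym edge_neq.
  case: aS => [sT|aS]; first by move: le_sub; rewrite sT setUT cardsT; lia.
  move: le_sub; rewrite cardsU1 aS; lia.
have [Q [pQ eQ [yQ iQ] oQ nQ]] := fill (step x y exy ltDx) pP xP (conj yP iP).
have xQ : x \in dom Q by case: eQ => /subsetP/(_ x xP).
have eyx : e y x by rewrite e_sym.
(* The invariant is symmetric in the two ends, so the same step serves [y]. *)
have iQ' : inv y x Q by split=> //; rewrite seenC addnAC.
have [R [pR eR [_ iR] oR nR]] := fill (step y x eyx ltDy) pQ yQ iQ'.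
exists R; split=> //; first exact: ext_trans eQ eR.
have oxR : outside R x = set0.
  apply/eqP; rewrite -subset0 -oQ; apply/subsetP => z; rewrite !outsideE.
  case/andP=> -> /=; apply: contra; case: eR => /subsetP sub _ _; exact: sub.
apply/eqP; rewrite eqEcard subsetT cardsT seenC.
by move: iR; rewrite oR oxR cards0 !addn0.
Qed.

Lemma extend P : (forall x y, connect e x y) -> (forall x, deg e x < #|C|) ->
  2 < #|C| -> valid P -> dom P != set0 ->
  exists Q, [/\ valid Q, ext P Q & dom Q = setT].
Proof.
move=> conn ltD C2; move: {2}#|~: dom P| (erefl #|~: dom P|) => k.
elim: k P => [|k IH] P cP pP nP.
  exists P; split=> //.
  by apply/eqP; rewrite -[dom P]setCK (cards0_eq cP) setC0.
have [/existsP[w /existsP[u /and3P[wP uP ewu]]]|] :=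
    boolP [exists w, exists u, [&& w \in dom P, u \notin dom P & e w u]].
  have [a aT] := free_colour (ltD w) uP ewu.
  have [b bT] := @fresh C [:: a; vc P w] C2.
  have eQ := ext_addv a b uP.
  have [|||R [pR eR dR]] := IH (addv P u a b).
  - move: cP; rewrite (cardsD1 u) inE uP add1n => -[<-].
    by apply: eq_card => z; rewrite /= !inE negb_or.
  - exact: valid_addv wP uP ewu aT bT.
  - by apply/set0Pn; exists u; rewrite /= setU11.
  by exists R; split=> //; apply: ext_trans eQ eR.
(* No edge leaves the domain, so a path from a coloured vertex to an uncoloured one cannot exist. *)
rewrite negb_exists => /forallP clos.
have [x xP] := set0Pn _ nP.
have /card_gt0P[y] : 0 < #|~: dom P| by rewrite cP.
rewrite inE => yP; case/negP: yP.
have /connectP[q pq ->] := conn x y.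
elim: q x xP pq => //= z q IHq x xP /andP[exz]; apply: IHq.
have := clos x; rewrite negb_exists => /forallP/(_ z).
by rewrite xP exz andbT negbK.
Qed.

(** * Reaching an element in a prescribed colour *)

Hypotheses (C5 : 5 < #|C|) (ltD : forall x, deg e x < #|C|).

Let C2 : 2 < #|C|. Proof. by apply: leq_trans C5. Qed.

Lemma ext_dom P Q x : ext P Q -> x \in dom P -> x \in dom Q.
Proof. by case=> /subsetP sub _ _; apply: sub. Qed.

(** With colour [j], the vertex [x] at once sees [j], the colour of [w] and that of [wx]. The other
    [deg e x - 1] neighbours give two colours each, in total [2 * deg e x + 1]. *)
Lemma targetV P w x j : valid P -> w \in dom P -> x \notin dom P -> e w x ->
  #|nbr P w| <= 2 -> j != vc P w -> #|C| <= 2 * deg e x + 1 ->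
  exists Q, [/\ valid Q, ext P Q, x \in dom Q /\ vc Q x = j, seenV Q x = setT
    & {in dom P, forall y, y != w -> nbr Q y = nbr P y}].
Proof.
move=> pP wP xP ewx nw jw dx.
have [|a [aT aj]] := @fresh_set (taken P w) [:: j].
  by have := card_taken P w; rewrite [size _]/=; lia.
rewrite inE in aj.
have aw : a != vc P w by apply: contra aT => /eqP->; apply: setU11.
have eQ := ext_addv a j xP; have pQ : valid (addv P x a j).
  by apply: (valid_addv pP wP) => //; rewrite !inE negb_or eq_sym aj.
have xQ : x \in dom (addv P x a j) by apply: setU11.
have := card_nbr_outside (addv P x a j) x.
have sub : [set j; vc P w; a] \subset seenV (addv P x a j) x.
  rewrite /seenV (nbr_addv_new _ _ pP wP xP ewx) !imset_set1 /= eqxx.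
  rewrite (neq_new xP wP); apply/subsetP => i; rewrite !inE.
  by case/orP=> [/orP[]|] ->; rewrite ?orbT.
have c3 : #|[set j; vc P w; a]| = 3.
  rewrite setUC cardsU1 cards2 jw !inE negb_or aj aw //.
move: (subset_leq_card sub); rewrite c3 (nbr_addv_new _ _ pP wP xP ewx) cards1.
move=> le3 cO.
have [|Q [pR eR sR nR]] := fillV C2 (ltD x) pQ xQ; first by lia.
exists Q; split=> //; first exact: ext_trans eQ eR.
  split; first exact: ext_dom eR xQ.
  by case: eR => _ -> //; rewrite /= eqxx.
move=> y yP yw; rewrite nR ?(ext_dom eQ) ?(neq_new xP) //.
by rewrite (nbr_addv _ _ pP wP xP ewx).
Qed.

(** With colour [j], the edge [wu] at once sees four colours: [j], those of [w] and [u], and that of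
    [w w0]. There remain [deg e w - 2] and [deg e u - 1] uncoloured neighbours at its ends, each
    giving one more. *)
Lemma targetE P w w0 u j : valid P -> w \in dom P -> u \notin dom P ->
  e w u -> nbr P w = [set w0] -> j \notin [:: vc P w; ec P w w0] ->
  #|C| <= deg e w + deg e u + 1 ->
  exists Q, [/\ valid Q, ext P Q, u \in dom Q, ec Q w u = j
    & seenE Q w u = setT].
Proof.
move=> pP wP uP ewu nw; rewrite !inE negb_or => /andP[jw jw0] dwu.
have /andP[w0P eww0] : (w0 \in dom P) && e w w0 by rewrite -nbrE nw set11.
have [_ /(_ _ _ wP w0P eww0)[_ neqw _] _] := pP.
have jT : j \notin taken P w by rewrite /taken nw imset_set1 !inE negb_or jw.
have [|b] := @fresh C [:: j; vc P w; ec P w w0]; first by apply: leq_trans C5.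
rewrite !inE !negb_or => /and3P[bj bw bw0].
have bT : b \notin [:: j; vc P w] by rewrite !inE negb_or bj.
have eQ := ext_addv j b uP; have pQ := valid_addv pP wP uP ewu jT bT.
have wQ := ext_dom eQ wP.
have uQ : u \in dom (addv P u j b) by apply: setU11.
have sub : [set vc P w; b] :|: [set j; ec P w w0]
    \subset seenE (addv P u j b) w u.
  rewrite /seenE /= eqxx (neq_new uP wP) setUS //.
  apply: subset_trans (subsetUl _ _).
  rewrite nbr_addv_at // nw !imsetU1 imset_set1 /= eqxx.
  by rewrite (neq_new uP w0P).
have c4 : #|[set vc P w; b] :|: [set j; ec P w w0]| = 4.
  rewrite -setUA !cardsU1 cards1 !inE !negb_or bj bw0 jw0.
  by rewrite ![vc P w == _]eq_sym bw jw neqw.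
have cw := card_nbr_outside (addv P u j b) w.
have cu := card_nbr_outside (addv P u j b) u.
move: cw cu (subset_leq_card sub).
rewrite c4 nbr_addv_at // (nbr_addv_new _ _ pP wP uP ewu) nw cards1 cards2.
rewrite (_ : u != w0); last by apply: contra uP => /eqP->.
move=> cw cu le4.
have [|Q [pR eR sR]] := fillE C2 (ltD w) (ltD u) pQ wQ uQ ewu.
  apply: leq_trans dwu _; rewrite -cw -cu; move: le4; clear.
  by move: #|seenE _ _ _| #|outside _ w| #|outside _ u| => /= s ow ou; lia.
exists Q; split=> //; first exact: ext_trans eQ eR.
  exact: ext_dom eR uQ.
by case: eR => _ _ ->; rewrite //= eqxx orbT.
Qed.

(** The state of the tip of a growing path: a single coloured edge, which leaves [j] free for the
    next one. *)
Definition avoids j P z : Prop := exists2 z0, nbr P z = [set z0] & ec P z z0 != j.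

(** New vertices and edges all avoid [j]. The start [z] may itself have colour [j], hence the
    condition [q != [::]] on the last vertex. *)
Lemma walk P z q j : valid P -> z \in dom P -> avoids j P z ->
  path e z q -> uniq q -> {in q, forall y, y \notin dom P} ->
  exists Q, [/\ valid Q, ext P Q, last z q \in dom Q /\ avoids j Q (last z q),
    q != [::] -> vc Q (last z q) != j &
    {subset dom Q <= [predU dom P & q]}].
Proof.
elim: q P z => [|u q IH] P z pP zP aP /=.
  by exists P; split=> // y; rewrite inE => ->.
case/andP=> ezu pq /andP[uq uniq_q] disj.
have uP : u \notin dom P by apply: disj; rewrite mem_head.
have [z0 nz ez0] := aP.
have [|a [aT aj]] := @fresh_set (taken P z) [:: j].
  by have := card_taken P z; rewrite nz cards1 [size _]/=; lia.
have [|b] := @fresh C [:: a; vc P z; j]; first by apply: leq_trans C5.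
rewrite !inE !negb_or => /and3P[ba bz bj]; rewrite inE in aj.
have bT : b \notin [:: a; vc P z] by rewrite !inE negb_or ba.
have eQ := ext_addv a b uP; have pQ := valid_addv pP zP uP ezu aT bT.
have uQ : u \in dom (addv P u a b) by apply: setU11.
have aQ : avoids j (addv P u a b) u.
  by exists z; rewrite ?(nbr_addv_new _ _ pP zP uP ezu) //= eqxx.
have [|R [pR eR [lR aR] vR sR]] := IH _ _ pQ uQ aQ pq uniq_q.
  move=> y yq; rewrite /= !inE negb_or disj ?inE ?yq ?orbT // andbT.
  by apply: contra uq => /eqP<-.
exists R; split=> //; first exact: ext_trans eQ eR.
  move=> _; have [q0|/vR//] := eqVneq q [::].
  by rewrite q0 /=; case: eR => _ -> //; rewrite /= eqxx.
move=> y /sR; rewrite /= !inE; case/orP=> [/orP[]|] ->; rewrite ?orbT //.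
Qed.

Lemma star v j (B : pred V) : deg e v + 1 < #|C| ->
  exists P, [/\ valid P, dom P =i [predU1 v & e v], vc P v != j &
    forall u, e v u -> ec P v u != j /\ (vc P u == j) = ~~ B u].
Proof.
move=> dv.
have [|c0] := @fresh C [:: j]; first by apply: leq_trans C5.
rewrite inE => c0j.
pose P0 := single v c0; have pP0 : valid P0 := valid_single v c0.
pose inv P := [/\ {subset dom P <= [predU1 v & e v]}, vc P v != j &
   {in nbr P v, forall u, ec P v u != j /\ (vc P u == j) = ~~ B u}].
have inv0 : inv P0.
  split=> //= [y|y]; first by rewrite !inE => ->.
  by rewrite nbrE => /andP[/set1P->]; rewrite e_irr.
have [|Q [pQ eQ [sQ vjQ iQ] oQ _]] := @fill v inv _ P0 pP0 (set11 v) inv0.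
- move=> P u pP vP [sP vj iP] uP evu.
  (* While a neighbour is uncoloured, at most [deg e v] colours are taken; with at least
     [deg e v + 2] available, one of the free ones differs from [j]. *)
  have [|a [aT aj]] := @fresh_set (taken P v) [:: j].
    have := card_taken P v; have := card_nbr_outside P v; rewrite [size _]/=.
    have : 0 < #|outside P v| by apply/card_gt0P; exists u; rewrite outsideE evu.
    by lia.
  rewrite inE in aj.
  have [b [bT bB]] : exists b, b \notin [:: a; vc P v] /\ (b == j) = ~~ B u.
    case: (B u) => /=.
      have [|b] := @fresh C [:: a; vc P v; j]; first by apply: leq_trans C5.
      rewrite !inE !negb_or => /and3P[ba bv /negbTE bj].
      by exists b; rewrite !inE negb_or ba.
    by exists j; rewrite !inE negb_or eqxx ![j == _]eq_sym aj.
  exists a, b; split=> //; split=> /=.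
  - by move=> y /setU1P[->|/sP//]; apply/predU1P; right.
  - by rewrite (neq_new uP vP).
  - move=> y; rewrite nbr_addv_at // => /setU1P[->|yN].
      by rewrite eqxx orbT.
    have yP : y \in dom P by move: yN; rewrite nbrE => /andP[].
    by rewrite (neq_new uP yP) (neq_new uP vP); apply: iP.
- have domQ u : e v u -> u \in dom Q.
    move=> evu; apply/negPn/negP => uQ.
    by have := in_set0 u; rewrite -oQ outsideE evu uQ.
  exists Q; split=> //.
    move=> y; apply/idP/idP => [/sQ//|]; rewrite !inE.
    by case/predU1P=> [->|]; [apply: ext_dom eQ (set11 v) | apply: domQ].
  by move=> u evu; apply: iQ; rewrite nbrE domQ.
Qed.

(** Some element of colour [j] is already b-chromatic. Seen sets only grow under extension, so this
    survives every later step. *)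
Definition represented P j : Prop :=
  (exists x, [/\ x \in dom P, vc P x = j & seenV P x = setT]) \/
  (exists x y, [/\ x \in dom P /\ y \in dom P, e x y, ec P x y = j
     & seenE P x y = setT]).

Lemma ext_represented P Q j : ext P Q -> represented P j -> represented Q j.
Proof.
move=> ePQ [[x [xP xj sx]]|[x [y [[xP yP] exy xj sxy]]]]; [left|right].
  exists x; split; first exact: ext_dom ePQ xP.
    by case: ePQ => _ ->.
  by apply/eqP; rewrite -subTset -sx ext_seenV.
exists x, y; split; rewrite ?(ext_dom ePQ) //.
  by case: ePQ => _ _ ->.
by apply/eqP; rewrite -subTset -sxy ext_seenE.
Qed.

End PartialColourings.

(** * From partial colourings to b-colourings *)

Section BColouring.

Lemma edge_ends (E : edge e) :
  exists q : V * V, e q.1 q.2 && (val E == [set q.1; q.2]).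
Proof.
have /imsetP[q] := valP E; rewrite inE => eq_ Eq.
by exists q; rewrite eq_ Eq /=.
Qed.

Lemma edge_at (E : edge e) z : z \in val E ->
  exists2 a, e z a & val E = [set z; a].
Proof.
have [[x y] /= /andP[exy /eqP->]] := edge_ends E.
by case/set2P=> ->; [exists y | exists x; rewrite 1?e_sym // setUC].
Qed.

Lemma edge_of x y : e x y -> exists E : edge e, val E = [set x; y].
Proof.
move=> exy; have xyE : [set x; y] \in edges e.
  by apply/imsetP; exists (x, y); rewrite ?inE.
by exists (Sub [set x; y] xyE); rewrite SubK.
Qed.

Lemma set2_inj_edge x y a b : e x y -> e a b -> [set x; y] = [set a; b] ->
  x = a /\ y = b \/ x = b /\ y = a.
Proof.
move=> exy eab eqs.
move: (edge_neq exy).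
have /set2P[-> | ->] : x \in [set a; b] by rewrite -eqs set21.
  have /set2P[-> | ->] : y \in [set a; b] by rewrite -eqs set22.
    by rewrite eqxx.
  by left.
have /set2P[-> | ->] : y \in [set a; b] by rewrite -eqs set22.
  by right.
by rewrite eqxx.
Qed.

Variable n : nat.
Implicit Types Q : pcol 'I_n.

Definition ends (E : edge e) : V * V := xchoose (edge_ends E).

Definition elt_colour Q (x : elt e) : 'I_n :=
  match x with
  | inl v => vc Q v
  | inr E => ec Q (ends E).1 (ends E).2
  end.

Section Complete.

Variable Q : pcol 'I_n.
Hypotheses (pQ : valid Q) (fullQ : dom Q = setT).

Let inQ x : x \in dom Q. Proof. by rewrite fullQ. Qed.

(** The chosen [ends] agree with [x], [y] up to order, which the symmetry of a valid [ec] makes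
    harmless. *)
Lemma elt_colour_edge (E : edge e) x y : e x y -> val E = [set x; y] ->
  elt_colour Q (inr E) = ec Q x y.
Proof.
move=> exy Exy; rewrite /=.
have /andP[] : e (ends E).1 (ends E).2 && (val E == [set (ends E).1; (ends E).2]).
  exact: xchooseP (edge_ends E).
case: (ends E) => a b /= ez /eqP; rewrite Exy.
have [_ /(_ x y (inQ x) (inQ y) exy)[_ _ sym_xy] _] := pQ.
by case/(set2_inj_edge exy ez) => [][<- <-].
Qed.

Lemma elt_colour_proper x y : elt_adj x y -> elt_colour Q x != elt_colour Q y.
Proof.
have [_ Hv He] := pQ.
have vE u (E : edge e) : u \in val E -> vc Q u != elt_colour Q (inr E).
  case/edge_at=> a eua Eua; rewrite (elt_colour_edge eua Eua) eq_sym.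
  by have [] := Hv u a (inQ u) (inQ a) eua.
case: x y => [u|E] [v|F] /=.
- by move=> euv; have [] := Hv u v (inQ u) (inQ v) euv.
- exact: vE.
- by rewrite eq_sym; apply: vE.
case/andP=> neqEF /set0Pn[z /setIP[zE zF]].
have [a eza Eza] := edge_at zE; have [b ezb Fzb] := edge_at zF.
rewrite -/(elt_colour Q (inr E)) -/(elt_colour Q (inr F)).
rewrite (elt_colour_edge eza Eza) (elt_colour_edge ezb Fzb).
apply: contra neqEF => /eqP /(He z a b (inQ z) (inQ a) (inQ b) eza ezb) eqab.
by apply/eqP/val_inj; rewrite /= Eza Fzb eqab.
Qed.

Lemma b_chromatic_of (c : {ffun elt e -> 'I_n}) x :
  (forall y, c y = elt_colour Q y) ->
  (forall i, i != elt_colour Q x -> exists2 y, elt_adj x y & elt_colour Q y = i) ->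
  total_b_chromatic c x.
Proof.
move=> cE seen; rewrite /total_b_chromatic; apply/eqP/setP=> i.
rewrite !inE cE; apply/imsetP/idP => [[y]|/seen[y xy <-]].
  by rewrite inE => /elt_colour_proper xy ->; rewrite cE eq_sym.
by exists y; rewrite ?inE.
Qed.

Lemma b_chromatic_vertex (c : {ffun elt e -> 'I_n}) x :
  (forall y, c y = elt_colour Q y) -> seenV Q x = setT ->
  total_b_chromatic c (inl x).
Proof.
move=> cE sx; apply: b_chromatic_of => // i ix.
have : i \in seenV Q x by rewrite sx in_setT.
rewrite /seenV in_setU1 (negbTE ix) /= => /setUP[]/imsetP[y].
  by rewrite nbrE => /andP[_ exy] ->; exists (inl y).
rewrite nbrE => /andP[_ exy] ->; have [E Exy] := edge_of exy.
exists (inr E); first by rewrite /= Exy set21.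
exact: elt_colour_edge.
Qed.

Lemma b_chromatic_edge (c : {ffun elt e -> 'I_n}) x y (E : edge e) :
  (forall y, c y = elt_colour Q y) -> e x y -> val E = [set x; y] ->
  seenE Q x y = setT ->   total_b_chromatic c (inr E).
Proof.
move=> cE exy Exy sx; apply: b_chromatic_of => // i iE.
have at_end z : z \in [set x; y] -> i \in ec Q z @: nbr Q z ->
    exists2 t, elt_adj (inr E) t & elt_colour Q t = i.
  move=> zxy /imsetP[t]; rewrite nbrE => /andP[_ ezt] it.
  have [F Fzt] := edge_of ezt; exists (inr F); last first.
    by rewrite (elt_colour_edge ezt Fzt).
  (* [F] has colour [i] and [E] does not, so they are different edges. *)
  apply/andP; split.
    apply: contra iE => /eqP->; rewrite it; apply/eqP/esym.
    exact: elt_colour_edge.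
  by apply/set0Pn; exists z; rewrite inE Exy Fzt zxy set21.
have : i \in seenE Q x y by rewrite sx in_setT.
case/setUP=> [/set2P[]->|/setUP[]].
- by exists (inl x); rewrite //= Exy set21.
- by exists (inl y); rewrite //= Exy set22.
- by apply: at_end; rewrite set21.
- by apply: at_end; rewrite set22.
Qed.

End Complete.

(** Greedy extension to the whole tree keeps the b-chromatic elements; having one in each class also
    makes the colouring surjective. *)
Lemma phi_ge (P : pcol 'I_n) :
  (forall x y, connect e x y) -> (forall x, deg e x < n) ->
  2 < n -> valid P -> dom P != set0 -> (forall j, represented P j) ->
  n <= phi_t e.
Proof.
move=> conn ltD n2 pP nP rP.
have [||Q [pQ eQ fQ]] := @extend _ P conn _ _ pP nP; rewrite ?card_ord //.
have {}rP j : represented Q j by apply: ext_represented eQ (rP j).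
pose c : {ffun elt e -> 'I_n} := [ffun x => elt_colour Q x].
have cE x : c x = elt_colour Q x by rewrite ffunE.
have bc j : exists x : elt e, (c x == j) && total_b_chromatic c x.
  case: (rP j) => [[x [_ xj sx]]|[x [y [_ exy xj sxy]]]].
    exists (inl x); rewrite cE /= xj eqxx.
    exact: (b_chromatic_vertex pQ fQ cE sx).
  have [E Exy] := edge_of exy; exists (inr E).
  rewrite cE (elt_colour_edge pQ fQ exy Exy) xj eqxx.
  exact: (b_chromatic_edge pQ fQ cE exy Exy sxy).
apply: (@phi_t_max _ _ n c); apply/andP; split; last first.
  by apply/forallP=> j; apply/existsP.
apply/andP; split.
  by apply/forallP=> j; apply/existsP; have [x /andP[]] := bc j; exists x.
apply/forallP=> x; apply/forallP=> y; apply/implyP => xy.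
by rewrite !cE elt_colour_proper.
Qed.

End BColouring.

End Trees.

(** * Total degrees *)

Section TotalDegree.

Variables (V : finType) (e : rel V).
Hypotheses (e_sym : symmetric e) (e_irr : irreflexive e).

(** In a non-increasing sequence the entries at least [t] form a prefix. *)
Lemma nth_sorted_geq (s : seq nat) t i : sorted geq s -> i < size s ->
  (t <= nth 0 s i) = (i < count (leq t) s).
Proof.
elim: s i => // x s IH [|i] /= ss; rewrite ?ltnS => lti.
  have [//|ltxt] := leqP t x; apply/esym/negbTE; rewrite -eqn0Ngt add0n.
  rewrite -leqn0 leqNgt -has_count; apply/hasPn => y ys; rewrite -ltnNge.
  apply: leq_ltn_trans ltxt; apply: (allP (order_path_min _ ss) _ ys).
  by move=> a b c /= ba cb; apply: leq_trans cb ba.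
rewrite (IH _ (path_sorted ss) lti).
have [_|ltxt] := leqP t x; first by rewrite add1n.
suff -> : count (leq t) s = 0 by [].
apply/eqP; rewrite -leqn0 leqNgt -has_count; apply/hasPn => y ys; rewrite -ltnNge.
apply: leq_ltn_trans ltxt; apply: (allP (order_path_min _ ss) _ ys).
by move=> a b c /= ba cb; apply: leq_trans cb ba.
Qed.

Lemma count_total_degs t :
  count (leq t) (total_degs e) = #|[set x : elt e | t <= total_deg x]|.
Proof.
rewrite /total_degs count_sort count_map cardE -size_filter; congr size.
by rewrite enumT; apply: eq_filter => x; rewrite /= inE.
Qed.

Lemma nth_total_degs i : i < size (total_degs e) ->
  (i <= nth 0 (total_degs e) i) =
  (i < #|[set x : elt e | i <= total_deg x]|).
Proof.
move=> lti; rewrite nth_sorted_geq ?count_total_degs //.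
by apply: sort_sorted => m k; apply: leq_total.
Qed.

(** Together with [card_total_dense] this describes [m_t] without sorting, as the largest [k] such
    that at least [k] elements have total degree at least [k - 1]. *)
Lemma m_t_ge k : k <= #|[set x : elt e | k.-1 <= total_deg x]| -> k <= m_t e.
Proof.
case: k => // k ltk /=.
have lti : k < size (total_degs e).
  by apply: leq_trans (count_size (leq k) _); rewrite count_total_degs.
apply: (@leq_bigmax_cond _ _ (fun i : 'I__ => i.+1) (Ordinal lti)).
by rewrite nth_total_degs.
Qed.

Lemma card_total_dense : m_t e <= #|[set x : elt e | total_dense x]|.
Proof.
rewrite [leqRHS](_ : _ = #|[set x : elt e | (m_t e).-1 <= total_deg x]|) //.
rewrite /m_t.
(* The property holds for 0 and for each admissible rank, and a maximum of two numbers is one of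
   them. *)
apply: (big_ind (fun k => k <= #|[set x : elt e | k.-1 <= total_deg x]|)).
- by [].
- by move=> a b; rewrite /maxn; case: ifP.
- by move=> i; rewrite nth_total_degs.
Qed.

(** A b-colouring with [k] colours has at least [k] b-chromatic elements, each adjacent to [k - 1]
    colours and so of total degree at least [k - 1]. *)
Lemma phi_t_le : phi_t e <= m_t e.
Proof.
apply/bigmax_leqP => k /existsP[c /andP[_ /forallP bc]]; apply: m_t_ge.
apply: (@leq_trans #|c @: [set x | total_b_chromatic c x]|).
  suff: #|[set: 'I_k]| <= #|c @: [set x | total_b_chromatic c x]|.
    by rewrite cardsT card_ord.
  apply/subset_leq_card/subsetP => j _.
  by have /existsP[x /andP[/eqP<- bx]] := bc j; rewrite imset_f ?inE.
apply: leq_trans (leq_imset_card _ _) _; apply/subset_leq_card/subsetP => x.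
rewrite !inE => /eqP cx; apply: leq_trans (leq_imset_card c _).
by rewrite cx cardsC1 card_ord.
Qed.

(** A clique for [elt_adj] with [deg e v + 1] elements. *)
Definition star_elts v : {set elt e} :=
  [set x : elt e | match x with inl u => u == v | inr E => v \in val E end].

(* The edge [xy], with the junk value [inl x] when [x] and [y] are not adjacent. *)
Definition elt_of x y : elt e :=
  if insub [set x; y] is Some E then inr E else inl x.

Lemma elt_ofE x y : e x y ->
  exists2 E : edge e, elt_of x y = inr E & val E = [set x; y].
Proof.
move=> exy; have [E Exy] := edge_of exy.
by exists E; rewrite // /elt_of -Exy valK.
Qed.

Lemma set2_inj (x y z : V) : x != y -> [set x; y] = [set x; z] -> y = z.
Proof.
move=> xy /setP/(_ y); rewrite !inE eqxx orbT eq_sym (negbTE xy) /=.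
by move=> /esym/eqP.
Qed.

Lemma card_star_elts v : #|star_elts v| = (deg e v).+1.
Proof.
have -> : star_elts v = inl v |: elt_of v @: [set w | e v w].
  apply/setP=> -[u|E]; rewrite !inE.
    case: eqP => [->|neq] /=; first by rewrite eqxx.
    have /negbTE-> : (inl u != inl v :> elt e) by apply/eqP => -[].
    apply/esym/imsetP => -[w]; rewrite inE => /elt_ofE[E -> _] //.
  rewrite /=; apply/idP/imsetP => [/(edge_at e_sym)[a eva Eva]|[w]].
    exists a; first by rewrite inE.
    have [F -> Fva] := elt_ofE eva; congr inr; apply: val_inj.
    by rewrite /= Eva.
  by rewrite inE => /elt_ofE[F -> Fvw] [->]; rewrite Fvw set21.
rewrite cardsU1 card_in_imset.
  rewrite (_ : _ \notin _) //; apply/imsetP => -[w].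
  by rewrite inE => /elt_ofE[E ->].
move=> a b; rewrite !inE => eva evb.
have [E -> Eva] := elt_ofE eva; have [F -> Fvb] := elt_ofE evb.
case=> eqEF; apply: (@set2_inj v); first by rewrite (edge_neq e_irr eva).
by rewrite -Eva -Fvb eqEF.
Qed.

Lemma star_adj v x y : x \in star_elts v -> y \in star_elts v -> y != x ->
  elt_adj x y.
Proof.
case: x y => [u|E] [w|F]; rewrite !inE /=.
- by move=> /eqP-> /eqP->; rewrite eqxx.
- by move=> /eqP->.
- by move=> vE /eqP->.
- move=> vE vF neqFE; apply/andP; split; last first.
    by apply/set0Pn; exists v; rewrite inE vE.
  by apply: contra neqFE => /eqP->.
Qed.

Lemma card_star_eltsD1 v x : x \in star_elts v ->
  #|star_elts v :\ x| = deg e v.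
Proof. by move=> xv; have := card_star_elts v; rewrite (cardsD1 x) xv => -[]. Qed.

Lemma deg_lt_m_t v : deg e v < m_t e.
Proof.
apply: m_t_ge; rewrite -(card_star_elts v); apply/subset_leq_card/subsetP => x xv.
rewrite inE card_star_elts -[_.-1]/(deg e v) -(card_star_eltsD1 xv).
apply/subset_leq_card/subsetP => y.
by rewrite !inE => /andP[yx yv]; apply: (@star_adj v); rewrite // inE.
Qed.

Lemma total_deg_vertex x : total_deg (inl x : elt e) <= 2 * deg e x.
Proof.
have xx : inl x \in star_elts x by rewrite inE.
rewrite mul2n -addnn -{1}(card_star_eltsD1 xx).
have <- : #|inl @: [set w | e x w] : {set elt e}| = deg e x.
  by rewrite card_imset // => a b [].
apply: leq_trans (leq_card_setU _ _); apply/subset_leq_card/subsetP.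
case=> [u|E]; rewrite !inE /= => h; last by rewrite h.
by apply/orP; right; rewrite imset_f ?inE.
Qed.

Lemma total_deg_edge (E : edge e) x y : e x y -> val E = [set x; y] ->
  total_deg (inr E : elt e) <= deg e x + deg e y.
Proof.
move=> exy Exy.
have Ex : inr E \in star_elts x by rewrite inE Exy set21.
have Ey : inr E \in star_elts y by rewrite inE Exy set22.
rewrite -(card_star_eltsD1 Ex) -(card_star_eltsD1 Ey).
apply: leq_trans (leq_card_setU _ _); apply/subset_leq_card/subsetP.
case=> [u|F]; rewrite !inE /=; first by rewrite Exy !inE.
case/andP=> neqEF /set0Pn[z]; rewrite inE Exy => /andP[zxy zF].
have -> : inr F != inr E :> elt e by apply: contra neqEF => /eqP[->].
by move: zxy zF => /set2P[]-> ->; rewrite ?orbT.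
Qed.

(** Besides its [deg e v] edges, [v] is adjacent to the vertex [l]. *)
Lemma leaf_nbr_total_dense v l : e v l -> deg e v + 2 = m_t e ->
  total_dense (inl v : elt e).
Proof.
move=> evl dv; rewrite /total_dense -dv addn2 /=.
have vv : inl v \in star_elts v by rewrite inE.
have lN : inl l \notin star_elts v :\ inl v.
  by rewrite !inE [l == v]eq_sym (negbTE (edge_neq e_irr evl)) andbF.
rewrite -(card_star_eltsD1 vv) -[leqLHS]add1n.
rewrite (_ : 1 + _ = #|inl l |: (star_elts v :\ inl v)|); last first.
  by rewrite cardsU1 lN.
apply/subset_leq_card/subsetP=> x /setU1P[->|]; first by rewrite inE.
by rewrite !inE => /andP[xv xs]; apply: (@star_adj v); rewrite // inE.
Qed.

(** An edge between two non-consecutive vertices of the path would close a cycle. *)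
Lemma path_edges_mem p x y : acyclic e -> is_path e p -> x \in p -> y \in p ->
  e x y -> [set x; y] \in path_edges p.
Proof.
move=> acyc /and3P[_]; elim: p => // z s IH /= pz /andP[zs us] xp yp exy.
have head a : e z a -> a \in s -> [set z; a] \in path_edges (z :: s).
  move=> eza aS; move: pz zs us; clear IH xp yp.
  case/splitPr: s / aS => -[|b q] r pz zs us.
    by rewrite /path_edges /= mem_head.
  suff: ~~ e z a by rewrite eza.
  apply: (@long_path_not_adj _ _ e_sym acyc z b a q).
    by move: pz; rewrite -cat_rcons cat_path => /andP[].
  move: zs us; rewrite -(cat_rcons a (b :: q) r) mem_cat negb_or cat_uniq.
  by case/andP=> zq _ /andP[uq _]; apply/andP.
move: xp yp; rewrite !inE => /predU1P[xz|xs] /predU1P[yz|ys].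
- by rewrite xz yz e_irr in exy.
- by rewrite xz in exy *; apply: head.
- by rewrite yz in exy *; rewrite setUC; apply: head; rewrite // e_sym.
have := IH (path_sorted pz) us xs ys exy.
by case: s {IH head pz zs us xs ys} => // a s; rewrite inE => ->; rewrite orbT.
Qed.

(** A leaf has total degree at most 2, so [x] is an edge with an end [l] off the path, hence a leaf.
    Its total degree is at most [deg e v + 1], and at least [m_t e - 1]. *)
Lemma pendant_total_dense p (x : elt e) : caterpillar e p -> 6 <= m_t e ->
  total_dense x -> ~~ on_path p x ->
  exists v l, [/\ e v l, deg e l = 1 & m_t e <= deg e v + 2].
Proof.
case=> -[_ _ acyc] [pp leafE] _ m6; rewrite /total_dense.
case: x => [v|E] dx /= xp.
  move: xp; rewrite leafE negbK => /eqP dv.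
  by move: dx (total_deg_vertex v); rewrite dv; lia.
have [[a b] /= /andP[eab /eqP Eab]] := edge_ends E.
have := total_deg_edge eab Eab.
have [ap|] := boolP (a \in p); last first.
  rewrite leafE negbK => /eqP da; exists b, a; split; rewrite 1?e_sym //.
  by move: dx; lia.
have [bp|] := boolP (b \in p); last first.
  rewrite leafE negbK => /eqP db; exists a, b; split=> //.
  by move: dx; lia.
by case/negP: xp; rewrite Eab; apply: path_edges_mem.
Qed.

End TotalDegree.

(** * A vertex of degree m - 1 or m - 2 *)

Section Cases.

Variables (V : finType) (e : rel V) (n : nat).
Hypotheses (e_sym : symmetric e) (e_irr : irreflexive e) (e_acyc : acyclic e).
Hypotheses (e_conn : forall x y, connect e x y) (ltD : forall x, deg e x < n).
Hypothesis n5 : 5 < n.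

Implicit Types P Q : pcol V 'I_n.

Let C5 : 5 < #|'I_n|. Proof. by rewrite card_ord. Qed.
Let ltDC x : deg e x < #|'I_n|. Proof. by rewrite card_ord. Qed.
Let C2 : 2 < #|'I_n|. Proof. exact: leq_trans C5. Qed.
Let C0 : 0 < #|'I_n|. Proof. exact: leq_trans C5. Qed.
Let n2 : 2 < n. Proof. exact: leq_trans n5. Qed.

Lemma deg_ge2 y a b : e y a -> e y b -> a != b -> 1 < deg e y.
Proof.
move=> eya eyb ab; have <- : #|[set a; b]| = 2 by rewrite cards2 ab.
by apply/subset_leq_card/subsetP => z /set2P[]->; rewrite inE.
Qed.

Lemma card_taken_valid P v : valid e P -> v \in dom P ->
  #|taken e P v| = #|nbr e P v|.+1.
Proof.
case=> _ Hv He vP.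
have inN u : u \in nbr e P v -> (u \in dom P) && e v u by rewrite nbrE.
rewrite cardsU1 card_in_imset.
  rewrite (_ : _ \notin _) //; apply/imsetP => -[u /inN/andP[uP evu]] eqv.
  by have [_ /eqP[]] := Hv v u vP uP evu.
by move=> a b /inN/andP[aP eva] /inN/andP[bP evb]; apply: He.
Qed.

Lemma nbr_full P v : (forall u, e v u -> u \in dom P) ->
  #|nbr e P v| = deg e v.
Proof.
move=> NP; apply: eq_card => u; rewrite nbrE inE andbC.
by have [/NP->|] := boolP (e v u).
Qed.

Lemma taken_seenV P v : taken e P v \subset seenV e P v.
Proof. exact/setUS/subsetUr. Qed.

(** In any full valid colouring the [n] elements of the clique at [v] have distinct colours, so each
    of them sees every colour. *)
Lemma phi_full_star v : deg e v = n.-1 -> n <= phi_t e.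
Proof.
move=> dv; have [c0 _] := @fresh 'I_n [::] C0.
pose P0 := single v c0; have pP0 : valid e P0 := valid_single e_irr v c0.
have [|Q [pQ eQ fQ]] := extend e_sym e_irr e_acyc e_conn ltDC C2 pP0.
  by apply/set0Pn; exists v; apply: set11.
have inQ x : x \in dom Q by rewrite fQ.
have tT : taken e Q v = setT.
  apply/eqP; rewrite eqEcard subsetT cardsT card_ord card_taken_valid //.
  by rewrite nbr_full // dv; lia.
apply: (phi_ge e_sym e_irr e_acyc e_conn ltD n2 pQ); first by apply/set0Pn; exists v.
move=> i; have : i \in taken e Q v by rewrite tT.
case/setU1P=> [->|/imsetP[u]].
  left; exists v; split=> //; apply/eqP.
  by rewrite -subTset -tT taken_seenV.
rewrite nbrE => /andP[_ evu] ->; right; exists v, u; split=> //.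
apply/eqP; rewrite -subTset -tT /taken /seenE.
by apply: setUSS; [rewrite sub1set set21 | apply: subsetUl].
Qed.

(** * A vertex of degree m - 2 with a pendant edge *)

Section Star.

Variables (v l : V).
Hypotheses (dv : deg e v + 2 = n) (evl : e v l) (dl : deg e l = 1).

(* [B] is the set of neighbours of [v] exempted from [j],
   the colour missing at [v]. *)
Definition star_of j (B : pred V) P : Prop :=
  [/\ valid e P, dom P =i [predU1 v & e v], vc P v != j &
    forall u, e v u -> ec P v u != j /\ (vc P u == j) = ~~ B u].

Lemma star_exists (B : pred V) : exists j P, star_of j B P.
Proof.
have [j _] := @fresh 'I_n [::] C0.
have [|P sP] := star e_sym e_irr e_acyc C5 j B (v := v).
  by rewrite card_ord -dv ltn_add2l.
by exists j, P.
Qed.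

Lemma star_dom j B P y : star_of j B P -> e v y -> y \in dom P.
Proof. by case=> _ dP _ _ evy; rewrite dP; apply/predU1P; right. Qed.

Lemma star_dom_c j B P : star_of j B P -> v \in dom P.
Proof. by case=> _ dP _ _; rewrite dP; apply/predU1P; left. Qed.

Lemma star_domN j B P y : star_of j B P -> y != v -> ~~ e v y -> y \notin dom P.
Proof.
by case=> _ dP _ _ yv nevy; rewrite dP; apply/negP => /predU1P[/eqP|]; apply/negP.
Qed.

Lemma star_nbr j B P y : star_of j B P -> e v y -> nbr e P y = [set v].
Proof.
move=> sP evy; apply/setP=> z; rewrite nbrE inE.
apply/andP/eqP => [[zP eyz]|->]; last by rewrite (star_dom_c sP) e_sym.
apply: contraTeq zP => zv; apply: star_domN sP zv _.
exact: (no_triangle e_sym e_irr e_acyc evy eyz).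
Qed.

Lemma star_ec_sym j B P y : star_of j B P -> e v y -> ec P y v = ec P v y.
Proof.
move=> sP evy; have [[_ Hv _] _ _ _] := sP.
by have [] := Hv v y (star_dom_c sP) (star_dom sP evy) evy.
Qed.

Lemma star_free j B P y : star_of j B P -> e v y -> B y ->
  j \notin [:: vc P y; ec P y v].
Proof.
move=> sP evy By; rewrite !inE negb_or (star_ec_sym sP evy).
have [_ _ _ /(_ y evy)[neqj eqj]] := sP.
by rewrite eq_sym eqj By eq_sym.
Qed.

(** The clique at [v] carries every colour but [j], so each of its elements only has to see [j]. The
    vertex [v] does so at [u0], an edge [vu] at [u] unless [u] is exempted; then [j] is found on
    another edge at [u], or the colour of [vu] is represented elsewhere. *)
Lemma star_phi j B P Q : star_of j B P -> valid e Q -> ext P Q ->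
  (exists2 u, e v u & ~~ B u) -> represented e Q j ->
  (forall u, e v u -> B u -> represented e Q (ec Q v u) \/
     exists z, [/\ z \in dom Q, e u z & ec Q u z = j]) ->
  n <= phi_t e.
Proof.
move=> sP pQ ePQ [u0 evu0 Bu0] rj rB.
have [_ _ vj Huj] := sP; have [_ vPQ ecPQ] := ePQ.
have vP := star_dom_c sP; have vQ := ext_dom ePQ vP.
have NP u : e v u -> u \in dom P by apply: star_dom sP.
have NQ u : e v u -> u \in dom Q by move/NP; apply: ext_dom.
have nQ u : e v u -> u \in nbr e Q v by move=> evu; rewrite nbrE NQ.
have vcQ u : e v u -> ~~ B u -> vc Q u = j.
  by move=> evu nB; rewrite vPQ ?NP //; apply/eqP; have [_ ->] := Huj u evu.
have jT : j \notin taken e Q v.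
  rewrite !inE negb_or vPQ // eq_sym vj /=; apply/imsetP => -[u].
  rewrite nbrE => /andP[_ evu]; rewrite (ecPQ _ _ vP (NP u evu)) => /esym/eqP.
  by have [/negbTE-> _] := Huj u evu.
have tj : taken e Q v = [set~ j].
  apply/eqP; rewrite eqEcard; apply/andP; split.
    by apply/subsetP => i iT; rewrite !inE; apply: contraNneq jT => <-.
  by rewrite cardsC1 card_ord card_taken_valid // nbr_full //; lia.
have full (S : {set 'I_n}) : taken e Q v \subset S -> j \in S -> S = setT.
  move=> sub jS; apply/eqP; rewrite -subTset; apply/subsetP => i _.
  have [->//|ij] := eqVneq i j; apply: (subsetP sub).
  by rewrite tj !inE.
apply: (phi_ge e_sym e_irr e_acyc e_conn ltD n2 pQ); first by apply/set0Pn; exists v.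
move=> i; have [->//|ij] := eqVneq i j.
have : i \in taken e Q v by rewrite tj !inE.
case/setU1P=> [->|/imsetP[u]].
  left; exists v; split=> //; apply: full; first exact: taken_seenV.
  rewrite -(vcQ u0) //; apply/setU1P; right; apply/setUP; left.
  exact/imset_f/nQ.
rewrite nbrE => /andP[uQ evu] ->.
have sub_edge : j \in seenE e Q v u -> represented e Q (ec Q v u).
  move=> jS; right; exists v, u; split=> //; apply: full => //.
  by apply: setUSS; [rewrite sub1set set21 | apply: subsetUl].
have [Bu|nBu] := boolP (B u); last first.
  by apply: sub_edge; rewrite -(vcQ u) // /seenE !inE eqxx orbT.
have [//|[z [zQ euz zj]]] := rB u evu Bu.
apply: sub_edge; rewrite -zj /seenE !inE; apply/orP; right; apply/orP; right.
by apply: imset_f; rewrite nbrE zQ.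
Qed.

(** When only [y] is exempted from [j], the leaf [l] is the neighbour from which [v] sees [j]. *)
Lemma not_leaf y a b : e y a -> e y b -> a != b -> l != y.
Proof.
move=> eya eyb ab; apply: contraTneq (deg_ge2 eya eyb ab) => <-.
by rewrite dl.
Qed.

Lemma phi_vertex1 y : e v y -> n <= 2 * deg e y + 1 -> n <= phi_t e.
Proof.
move=> evy dy; have [j [P sP]] := star_exists pred0.
have [pP _ vj /(_ y evy)[ecj /eqP vcj]] := sP.
have yP := star_dom sP evy; have ny := star_nbr sP evy.
have seq : seenV e P y = [set j; vc P v; ec P v y].
  by rewrite /seenV ny !imset_set1 vcj (star_ec_sym sP evy) -setUA.
have c3 : #|seenV e P y| = 3.
  rewrite seq setUC cardsU1 cards2 !inE negb_or ecj [j == _]eq_sym vj.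
  have [_ Hv _] := pP; have [_ -> _] := Hv v y (star_dom_c sP) yP evy.
  by [].
have [|Q [pQ eQ sQ _]] := fillV e_sym e_irr e_acyc C2 (ltDC y) pP yP.
  have := card_nbr_outside e P y; rewrite c3 ny cards1 card_ord => co.
  by move: dy; rewrite -co; move: #|outside _ _ _| => o; lia.
apply: (star_phi sP pQ eQ) => //; first by exists l.
left; exists y; split=> //; first exact: ext_dom eQ yP.
by case: eQ => _ -> //; rewrite vcj.
Qed.

(** The edge [yu] gets colour [j], so [y] must be exempted; the same edge then shows [j] to [vy]. *)
Lemma phi_edge1 y u : e v y -> e y u -> u != v ->
  n <= deg e y + deg e u + 1 -> n <= phi_t e.
Proof.
move=> evy eyu uv dyu; have [j [P sP]] := star_exists (pred1 y).
have [pP _ _ _] := sP.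
have yP := star_dom sP evy; have ny := star_nbr sP evy.
have uP : u \notin dom P.
  by apply: star_domN sP uv _; apply: no_triangle evy eyu.
have [||Q [pQ eQ uQ jQ sQ]] :=
  targetE e_sym e_irr e_acyc C5 ltDC pP yP uP eyu ny (j := j).
- by apply: star_free sP evy _; rewrite /= eqxx.
- by rewrite card_ord.
have eyv : e y v by rewrite e_sym.
apply: (star_phi sP pQ eQ).
- by exists l => //=; apply: not_leaf eyu eyv uv.
- right; exists y, u; split=> //; split=> //; exact: ext_dom eQ yP.
- by move=> u' _ /eqP->; right; exists u.
Qed.

(** With [j] on [x], the vertex [y] cannot have it; a third neighbour [z] lets the edge [yz] show
    [j] to [vy]. *)
Lemma phi_vertex2 y x z : e v y -> e y x -> x != v -> e y z -> z != v ->
  z != x -> n <= 2 * deg e x + 1 -> n <= phi_t e.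
Proof.
move=> evy eyx xv eyz zv zx dx; have [j [P sP]] := star_exists (pred1 y).
have [pP _ _ Huj] := sP.
have yP := star_dom sP evy; have ny := star_nbr sP evy.
have NP u : e y u -> u != v -> u \notin dom P.
  by move=> eyu uv; apply: star_domN sP uv _; apply: no_triangle evy eyu.
have jF : j \notin [:: vc P y; ec P y v].
  by apply: star_free sP evy _; rewrite /= eqxx.
have jT : j \notin taken e P y.
  by move: jF; rewrite /taken ny imset_set1 !inE.
have [b bT] := @fresh 'I_n [:: j; vc P y] C2.
have zP := NP z eyz zv.
have eQ := ext_addv j b zP.
have pQ := valid_addv e_sym e_irr e_acyc pP yP zP eyz jT bT.
have xQ : x \notin dom (addv P z j b).
  by rewrite /= !inE negb_or eq_sym zx NP.
have yQ := ext_dom eQ yP.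
have zQ : z \in dom (addv P z j b) by apply: setU11.
have [|||R [pR eR [xR xj] sR _]] :=
  targetV e_sym e_irr e_acyc C5 ltDC pQ yQ xQ eyx (j := j).
- by rewrite nbr_addv_at // ny cards2; case: (_ != _).
- rewrite /= (neq_new zP yP); by move: jF; rewrite !inE negb_or => /andP[].
- by rewrite card_ord.
have eyv : e y v by rewrite e_sym.
apply: (star_phi sP pR (ext_trans eQ eR)).
- by exists l => //=; apply: not_leaf eyx eyv xv.
- by left; exists x.
- move=> u' _ /eqP->; right; exists z; split=> //; first exact: ext_dom eR zQ.
  by case: eR => _ _ -> //; rewrite /= eqxx orbT.
Qed.

Lemma phi_far y q x : path e v (y :: rcons q x) -> uniq (v :: y :: rcons q x) ->
  q != [::] ->
  n <= 2 * deg e x + 1 \/ n <= deg e (last y q) + deg e x + 1 -> n <= phi_t e.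
Proof.
move=> pq uq q0 dx; have [j [P sP]] := star_exists pred0.
have [pP _ _ Huj] := sP.
have /andP[evy] : e v y && path e y (rcons q x) by [].
rewrite rcons_path => /andP[pyq ewx].
have yP := star_dom sP evy; have ny := star_nbr sP evy.
have notP z : z \in rcons q x -> z \notin dom P.
  move=> zq; apply: star_domN sP _ _.
    by apply: contraTneq uq => <-; rewrite /= inE zq orbT.
  (* A later vertex of the path adjacent to [v] would close a cycle. *)
  case/splitPr: {1 2}_ / zq pq uq => q1 q2 pq uq.
  apply: (@long_path_not_adj _ _ e_sym e_acyc v y z q1).
    by move: pq; rewrite -cat_rcons /= cat_path => /andP[-> /andP[]].
  by move: uq; rewrite -cat_rcons -!cat_cons cat_uniq => /andP[].
have aP : avoids e j P y.
  exists v; rewrite // (star_ec_sym sP evy).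
  by have [] := Huj y evy.
have uxq : x \notin q /\ uniq q.
  by move: uq; rewrite /= rcons_uniq => /and4P[].
have [||Q [pQ eQ [wQ [w0 nw w0j]] vQ sQ]] := walk e_sym e_irr e_acyc C5 pP yP aP pyq.
- by case: uxq.
- by move=> z zq; apply: notP; rewrite mem_rcons inE zq orbT.
have xQ : x \notin dom Q.
  apply/negP => /sQ; rewrite !inE (negbTE uxq.1) orbF; apply/negP/notP.
  by rewrite mem_rcons mem_head.
have wj := vQ q0.
suff [R [pR eR rR]] : exists R, [/\ valid e R, ext Q R & represented e R j].
  by apply: (star_phi sP pR (ext_trans eQ eR)) => //; exists l.
case: dx => dx.
  have [|||R [pR eR [xR xj] sR _]] :=
  targetV e_sym e_irr e_acyc C5 ltDC pQ wQ xQ ewx (j := j).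
  - by rewrite nw cards1.
  - by rewrite eq_sym.
  - by rewrite card_ord.
  by exists R; split=> //; left; exists x.
have [||R [pR eR xR xj sR]] :=
  targetE e_sym e_irr e_acyc C5 ltDC pQ wQ xQ ewx nw (j := j).
- by rewrite !inE negb_or ![j == _]eq_sym wj.
- by rewrite card_ord.
exists R; split=> //; right; exists (last y q), x; split=> //; split=> //.
exact: ext_dom eR wQ.
Qed.

(** The vertex [x] represents [j], which forces [y] to be exempted. The edge [vy] may then miss [j],
    so its colour is represented by [x'] instead. *)
Lemma phi_two_vertices y x y' x' : e v y -> e y x -> x != v ->
  e v y' -> e y' x' -> x' != v -> y' != y ->
  n <= 2 * deg e x + 1 -> n <= 2 * deg e x' + 1 -> n <= phi_t e.
Proof.
move=> evy eyx xv evy' eyx' xv' yy' dx dx'.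
have [j [P sP]] := star_exists (pred1 y).
have [pP _ _ Huj] := sP.
have yP := star_dom sP evy; have ny := star_nbr sP evy.
have yP' := star_dom sP evy'; have ny' := star_nbr sP evy'.
have xP : x \notin dom P by apply: star_domN sP xv _; apply: no_triangle evy eyx.
have xP' : x' \notin dom P.
  by apply: star_domN sP xv' _; apply: no_triangle evy' eyx'.
have [|||Q [pQ eQ [xQ xj] sQ nQ]] :=
  targetV e_sym e_irr e_acyc C5 ltDC pP yP xP eyx (j := j).
- by rewrite ny cards1.
- have := star_free sP evy; rewrite /= eqxx => /(_ isT).
  by rewrite !inE negb_or => /andP[].
- by rewrite card_ord.
have nQ' : nbr e Q y' = [set v] by rewrite nQ.
have yQ' := ext_dom eQ yP'.
have xQ' : x' \notin dom Q.
  apply: contra xv' => xQ'; rewrite -in_set1 -nQ' nbrE xQ' //.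
have [|||R [pR eR [xR' xj'] sR' _]] :=
  targetV e_sym e_irr e_acyc C5 ltDC pQ yQ' xQ' eyx' (j := ec P v y).
- by rewrite nQ' cards1.
(* The vertex [y'] has colour [j], the edge [vy] does not; so [x'] may repeat the colour of [vy]. *)
- have [_ -> //] := eQ; have [_ /eqP] := Huj y' evy'.
  rewrite /= (negbTE yy') => /eqP/eqP->.
  by have [] := Huj y evy.
- by rewrite card_ord.
have eyv : e y v by rewrite e_sym.
apply: (star_phi sP pR (ext_trans eQ eR)).
- by exists l => //=; apply: not_leaf eyx eyv xv.
- by apply: ext_represented eR _; left; exists x.
- move=> u' _ /eqP->; left; left; exists x'; split=> //; rewrite xj'.
  case: (ext_trans eQ eR) => _ _ -> //; exact: star_dom_c sP.
Qed.

Lemma path_to x : x != v -> exists q,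
  path e v (rcons q x) /\ uniq (v :: rcons q x).
Proof.
move=> xv; have /connectP[q0 pq0 lq0] := e_conn v x.
case/shortenP: pq0 lq0 => q pq uq _ lq.
case/lastP: q pq uq lq => [|q z] pq uq; first by move/eqP; rewrite (negbTE xv).
by rewrite last_rcons => ->; exists q.
Qed.

(** Take a path from [v] to [a]. Either [b] can be appended, or [b] lies on it and the part up to
    [b] continues directly to [a]. *)
Lemma path_to_edge a b : e a b -> a != v -> b != v -> exists q w u,
  [/\ path e v (rcons (rcons q w) u), uniq (v :: rcons (rcons q w) u)
    & [set w; u] = [set a; b]].
Proof.
move=> eab av bv; have [q [pq uq]] := path_to av.
have [bq|bq] := boolP (b \in rcons q a); last first.
  exists q, a, b; split=> //; first by rewrite rcons_path pq last_rcons.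
  by rewrite -rcons_cons rcons_uniq uq inE negb_or bv bq.
move: bq; rewrite mem_rcons inE eq_sym (negbTE (edge_neq e_irr eab)) /= => bq.
case/splitPr: bq pq uq => q1 q2; rewrite rcons_cat -cat_rcons => pq uq.
exists q1, b, a; split; last exact: setUC.
  rewrite rcons_path last_rcons e_sym eab andbT.
  by move: pq; rewrite cat_path => /andP[].
rewrite -[_ && _]/(uniq (v :: rcons (rcons q1 b) a)) -rcons_cons rcons_uniq.
move: uq; rewrite -cat_cons cat_uniq => /and3P[-> /hasPn/(_ a) nq _].
by rewrite andbT nq // mem_rcons mem_head.
Qed.

(** Cases on the length of the path from [v] to [x]. Only a vertex at distance 2 whose predecessor
    has no third neighbour escapes the constructions. *)
Lemma phi_or_pivot (x : elt e) : x \notin star_elts e v -> n <= (total_deg x).+1 ->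
  n <= phi_t e \/
  exists u w, [/\ x = inl u, e v w, e w u, u != v & deg e w = 2].
Proof.
case: x => [u|E]; rewrite inE /= => xv dx.
  have {}dx : n <= 2 * deg e u + 1.
    by apply: leq_trans dx _; rewrite addn1 ltnS total_deg_vertex.
  have [[|y [|y2 q]] [pq uq]] := path_to xv.
  - left; apply: (phi_vertex1 _ dx).
    by move: pq; rewrite /= andbT.
  - have /and3P[evy eyu _] : [&& e v y, e y u & true] by [].
    have eyv : e y v by rewrite e_sym.
    have [dy|dy] := eqVneq (deg e y) 2; first by right; exists u, y.
    left; have d2 := deg_ge2 eyu eyv xv.
    have /card_gt0P[z] : 0 < #|[set w | e y w] :\: [set u; v]|.
      rewrite cardsD subn_gt0.
      apply: leq_ltn_trans (subset_leq_card (subsetIr _ _)) _.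
      by rewrite cards2 xv ltn_neqAle eq_sym dy.
    rewrite !inE negb_or => /andP[/andP[zu zv] eyz].
    exact: (phi_vertex2 evy eyu xv eyz zv zu dx).
  - by left; apply: (@phi_far y (y2 :: q) u pq uq) => //; left.
have [[a b] /= /andP[eab /eqP Eab]] := edge_ends E.
move: xv; rewrite Eab !inE negb_or ![v == _]eq_sym => /andP[av bv].
have [q [w [u [pq uq wuE]]]] := path_to_edge eab av bv; left.
have ewu : e w u by move: pq; rewrite rcons_path last_rcons => /andP[].
rewrite -wuE in Eab.
have {}dx : n <= deg e w + deg e u + 1.
  by apply: leq_trans dx _; rewrite addn1 ltnS (total_deg_edge e_sym e_irr ewu).
case: q pq uq => [|y q] pq uq.
  have /and3P[evw _ _] : [&& e v w, e w u & true] by [].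
  apply: (phi_edge1 evw ewu _ dx).
  by apply: contraTneq uq => ->; rewrite /= !inE eqxx orbT.
apply: (@phi_far y (rcons q w) u pq uq); first by case: (q).
by right; rewrite last_rcons.
Qed.

End Star.
End Cases.

Theorem theorem4 (V : finType) (e : rel V) (p : seq V) :
  simple_graph e ->
  caterpillar e p ->
  6 <= m_t e ->
  ~ total_pivoted e p ->
  (exists x : elt e, total_dense x /\ ~~ on_path p x) ->
  phi_t e = m_t e.
Proof.
move=> [e_sym e_irr] cat_p m6 npiv [x0 [dx0 x0p]].
have [[_ conn acyc] _ _] := cat_p.
apply/eqP; rewrite eqn_leq phi_t_le /=.
have ltD := deg_lt_m_t e_sym e_irr.
have [v [l [evl dl dv]]] := pendant_total_dense e_sym e_irr cat_p m6 dx0 x0p.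
have [dv1|dv1] := eqVneq (deg e v) (m_t e).-1.
  exact: (phi_full_star e_sym e_irr acyc conn ltD m6 dv1).
have {dv1}dv : deg e v + 2 = m_t e by move: (ltD v); lia.
set D := [set x : elt e | total_dense x].
have cD : m_t e <= #|D| := card_total_dense e.
have cS : #|star_elts e v|.+1 = m_t e by rewrite card_star_elts // -dv addn2.
have dense x : x \in D -> m_t e <= (total_deg x).+1.
  by rewrite inE /total_dense; lia.
have pivot x : x \in D :\: star_elts e v -> m_t e <= phi_t e \/
    exists u w, [/\ x = inl u, e v w, e w u, u != v & deg e w = 2].
  case/setDP=> /dense xD xS.
  exact: (phi_or_pivot e_sym e_irr acyc conn ltD m6 dv evl dl xS xD).
have cDS : #|D| <= #|D :\: star_elts e v| + #|star_elts e v|.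
  by rewrite -(cardsID (star_elts e v) D) addnC leq_add2l subset_leq_card ?subsetIr.
(* At least [m_t e] elements are dense, and the clique at [v] has only [m_t e - 1]. *)
have /card_gt0P[x xD] : 0 < #|D :\: star_elts e v| by lia.
have [//|[u [w [xu evw ewu uv dw]]]] := pivot x xD.
have dense_u : total_dense (inl u : elt e) by move: xD; rewrite xu !inE => /andP[].
(* With exactly [m_t e] dense elements, [v], [w], [u] would form a [pivot_vertex]. So there are
   more, and a second dense element lies outside the clique. *)
have cDn : #|D| != m_t e.
  apply/eqP=> cDm; apply: npiv; split=> //; left; exists v, w, u; split=> //.
  - exact: leaf_nbr_total_dense evl dv.
  - by rewrite -dv addnK.
  - by split=> //; apply/eqP.
have /card_gt0P[x'] : 0 < #|(D :\: star_elts e v) :\ x|.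
  by have := cardsD1 x (D :\: star_elts e v); rewrite xD; lia.
rewrite in_setD1 => /andP[xx' xD'].
have [//|[u' [w' [xu' evw' ewu' uv' dw']]]] := pivot x' xD'.
have deg_vertex z : inl z \in D -> m_t e <= 2 * deg e z + 1.
  by move/dense => dz; apply: leq_trans dz _; rewrite addn1 ltnS total_deg_vertex.
apply: (phi_two_vertices e_sym e_irr acyc conn ltD m6 dv evl dl
         evw ewu uv evw' ewu' uv').
(* If [w = w'], then [u], [u'] and [v] would be three neighbours of a vertex of degree 2. *)
- apply: contraNneq xx' => ww'; rewrite xu xu'; apply/eqP; congr inl.
  apply/eqP/negPn/negP => uu'; move: dw'; rewrite ww'.
  suff : 2 < deg e w by move=> + dw2; rewrite dw2.
  rewrite (_ : 3 = #|[set u'; u; v]|).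
    apply/subset_leq_card/subsetP => z; rewrite !inE.
    by move=> /orP[/orP[]|] /eqP->; rewrite ?ewu // ?(e_sym w v) -?ww' //.
  by rewrite setUC cardsU1 cards2 !inE negb_or ![v == _]eq_sym uv' uv uu'.
- by apply: deg_vertex; rewrite -xu; case/setDP: xD.
- by apply: deg_vertex; rewrite -xu'; case/setDP: xD'.
Qed.
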